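(* Let $G$ be a group and let $n,m\ge 0$ be integers. The following are equivalent: (1) $G$ admits a presentation of the form $$\Big\langle a_1,\dots,a_n,c_1,\dots,c_m \ \Big|\ [a_i,a_j]=\prod_{t=1}^m c_t^{\lambda_t^{ij}}\ (1\le i<j\le n),\ [a_i,c_j]=[c_k,c_r]=1 \text{ for all } i,j,k,r\Big\rangle$$ for some integers $\lambda_t^{ij}$. (2) $G$ is a finitely generated, torsion-free, $2$-step nilpotent group satisfying $\mathrm{rank}(G/Z(G))+\mathrm{rank}(Z(G))=n+m$ and $\mathrm{rank}(G')\le m\le \mathrm{rank}(Z(G))$. Consequently, $G$ is finitely generated, torsion-free and $2$-step nilpotent if and only if it admits a presentation of the form in (1) for some $n,m\ge0$.
   Context: Commutators: $[g,h]=g^{-1}h^{-1}gh$. A group is $2$-step nilpotent if all commutators lie in its center (this includes abelian groups). The rank of a finitely generated abelian group is the minimum cardinality of a generating set. *)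

(* Defs.v *)
From Stdlib Require Import ZArith Arith.

Record group := Group {
  carrier :> Type;
  gmul : carrier -> carrier -> carrier;
  ginv : carrier -> carrier;
  gone : carrier;
  gmulA : forall x y z, gmul x (gmul y z) = gmul (gmul x y) z;
  gmul1x : forall x, gmul gone x = x;
  gmulVx : forall x, gmul (ginv x) x = gone
}.

Arguments gmul {g} _ _.
Arguments ginv {g} _.
Arguments gone {g}.

Section GroupDefs.
Variable G : group.

Fixpoint npow (x : G) (k : nat) : G :=
  match k with O => gone | S k' => gmul (npow x k') x end.

Definition zpow (x : G) (k : Z) : G :=
  if (0 <=? k)%Z then npow x (Z.to_nat k) else ginv (npow x (Z.to_nat (- k))).

Definition comm (g h : G) : G := gmul (gmul (gmul (ginv g) (ginv h)) g) h.

Fixpoint prod_upto (k : nat) (f : nat -> G) : G :=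
  match k with O => gone | S k' => gmul (prod_upto k' f) (f k') end.

Inductive gen (S : G -> Prop) : G -> Prop :=
| gen_base : forall x, S x -> gen S x
| gen_one : gen S gone
| gen_mul : forall x y, gen S x -> gen S y -> gen S (gmul x y)
| gen_inv : forall x, gen S x -> gen S (ginv x).

Definition fam (k : nat) (x : nat -> G) : G -> Prop :=
  fun y => exists i, i < k /\ y = x i.

Definition finitely_generated : Prop :=
  exists k (x : nat -> G), forall g, gen (fam k x) g.

Definition torsion_free : Prop :=
  forall (g : G) (k : nat), 0 < k -> npow g k = gone -> g = gone.

Definition in_center (z : G) : Prop := forall y, gmul z y = gmul y z.

(* 2-step nilpotent: all commutators are central (includes abelian) *)
Definition two_step_nilpotent : Prop := forall g h, in_center (comm g h).

Definition derived : G -> Prop := gen (fun x => exists g h, x = comm g h).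

Definition sub_gen_by (S : G -> Prop) (k : nat) : Prop :=
  exists x : nat -> G, (forall i, i < k -> S (x i)) /\
    (forall g, S g <-> gen (fam k x) g).

Definition sub_rank (S : G -> Prop) (r : nat) : Prop :=
  sub_gen_by S r /\ forall k, sub_gen_by S k -> r <= k.

(* G/Z(G) is generated by k elements: there are x_0..x_{k-1} in G whose
   cosets generate G/Z(G), i.e. G = < x_0, ..., x_{k-1}, Z(G) > *)
Definition quot_center_gen_by (k : nat) : Prop :=
  exists x : nat -> G, forall g, gen (fun y => fam k x y \/ in_center y) g.

Definition quot_center_rank (r : nat) : Prop :=
  quot_center_gen_by r /\ forall k, quot_center_gen_by k -> r <= k.

Definition pres_relations (n m : nat) (lam : nat -> nat -> nat -> Z)
    (a c : nat -> G) : Prop :=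
  (forall i j, i < j -> j < n ->
     comm (a i) (a j) = prod_upto m (fun t => zpow (c t) (lam i j t))) /\
  (forall i j, i < n -> j < m -> comm (a i) (c j) = gone) /\
  (forall k r, k < m -> r < m -> comm (c k) (c r) = gone).

End GroupDefs.

Arguments npow {G} _ _.
Arguments zpow {G} _ _.
Arguments comm {G} _ _.
Arguments gen {G} _ _.
Arguments in_center {G} _.
Arguments derived {G} _.

Definition group_hom (G H : group) (f : G -> H) : Prop :=
  forall x y, f (gmul x y) = gmul (f x) (f y).

(* G admits the presentation (1) with parameters lam: there are elements
   satisfying the relations, generating G, and G has the universal property
   of the presented group (every assignment of the generators in any group H
   satisfying the relations extends to a homomorphism G -> H). *)
Definition has_presentation_with (G : group) (n m : nat)
    (lam : nat -> nat -> nat -> Z) : Prop :=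
  exists a c : nat -> G,
    pres_relations G n m lam a c /\
    (forall g, gen (fun y => fam G n a y \/ fam G m c y) g) /\
    (forall (H : group) (a' c' : nat -> H),
        pres_relations H n m lam a' c' ->
        exists f : G -> H, group_hom G H f /\
          (forall i, i < n -> f (a i) = a' i) /\
          (forall j, j < m -> f (c j) = c' j)).

Definition has_presentation (G : group) (n m : nat) : Prop :=
  exists lam : nat -> nat -> nat -> Z, has_presentation_with G n m lam.

(* Main.v *)
(* Both conditions are equivalent to the existence of a central subgroup C
   containing all commutators with G/C free abelian of rank n and C free abelian
   of rank m.  Presentation => C: take C = <c_1,...,c_m>; every element has the
   form a^v c^u, and mapping to Z^n x Z^m with the multiplication twisted by the
   bilinear form sum_(i<j) lambda^(ij) v_i w_j shows that v and u are unique.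
   C => presentation: lift bases; see [independent_universal].  The ranks are
   additive in C <= Z(G) <= G because G/Z(G) is torsion-free, so that Z(G)/C is a
   direct summand of G/C.  Conversely, the isolator of G' in Z(G) is a direct
   summand of rank rank(G'), which is enlarged to a direct summand C of rank m.
   Lattice facts come from the Smith normal form. *)
Require Import Defs.
From mathcomp Require all_boot all_order all_algebra boolp zify.
From Stdlib Require Import ZArith Arith.

(* MathComp is imported inside a module so that its [nat] notations do not
   capture those of the theorem. *)
Module NilpotentPresentation.

Import all_boot all_order all_algebra boolp zify.
Import Order.TTheory GRing.Theory Num.Theory.

Set Implicit Arguments.
Unset Strict Implicit.
Unset Printing Implicit Defensive.

Local Open Scope ring_scope.
Local Infix "**" := gmul (at level 40, left associativity).

(** * Sublattices of Z^k *)

(** Freeness and rank are needed for many subquotients: G/Z(G), G/C, Z(G)/C, C, G' and its isolator.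
    They are all treated as instances of one relative notion T/S, where a coordinate function on T
    whose kernel is S replaces the quotient. Since Z^k is torsion-free, everything reduces to pure
    sublattices of Z^k. G/Z(G) is torsion-free because [x^k,y] = [x,y]^k in class 2. The
    inequalities on m come from the constraints on C: it lies in Z(G), so m <= rank Z(G); it
    contains G', and G/C is torsion-free, so it contains the isolator of G'. That isolator has the
    rank of G', because each of its elements has a positive power in G'. Once C has rank m, the
    condition on the sum of the ranks says exactly that G/C has rank n. *)

Definition lattice k (L : 'rV[int]_k -> Prop) : Prop :=
  L 0 /\ forall v w, L v -> L w -> L (v - w).

Lemma latticeN k (L : 'rV[int]_k -> Prop) v : lattice L -> L v -> L (- v).
Proof. by move=> [L0 LB] Lv; rewrite -sub0r; apply: LB. Qed.

Lemma latticeD k (L : 'rV[int]_k -> Prop) v w :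
  lattice L -> L v -> L w -> L (v + w).
Proof. by move=> HL Lv Lw; rewrite -[w]opprK; apply: HL.2 => //; exact: latticeN. Qed.

Lemma latticeMz k (L : 'rV[int]_k -> Prop) v z : lattice L -> L v -> L (z *: v).
Proof.
move=> HL Lv; have Hn n : L (n%:Z *: v).
  elim: n => [|n IHn]; first by rewrite scale0r; exact: HL.1.
  by rewrite intS scalerDl scale1r; apply: latticeD.
case: (intP z) => [|n|n]; [exact: Hn 0%N|exact: Hn|].
by rewrite scaleNr; apply: latticeN.
Qed.

Lemma lattice_sum k (L : 'rV[int]_k -> Prop) (I : finType) (F : I -> 'rV[int]_k) :
  lattice L -> (forall i, L (F i)) -> L (\sum_i F i).
Proof.
move=> HL HF; apply: (big_ind L) => //; first exact: HL.1.
by move=> v w; exact: latticeD.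
Qed.

Lemma lattice_full k (L : 'rV[int]_k -> Prop) v :
  lattice L -> (forall i, L (delta_mx 0 i)) -> L v.
Proof.
move=> HL HF; rewrite (row_sum_delta v); apply: lattice_sum => // i.
exact: latticeMz.
Qed.

(** Euclidean descent: an element of least positive absolute value divides all others, since a
    nonzero remainder would be smaller. [D] is an arbitrary predicate, so the case distinctions are
    classical. *)
Lemma int_subgroup_principal (D : int -> Prop) :
  D 0 -> (forall x y, D x -> D y -> D (x - y)) ->
  exists d, D d /\ forall x, D x -> (d %| x)%Z.
Proof.
move=> D0 DB.
have DN x : D x -> D (- x) by move=> Dx; rewrite -sub0r; exact: DB.
have DM x z : D x -> D (z * x).
  move=> Dx; have Hn n : D (n%:Z * x).
    elim: n => [|n IHn]; first by rewrite mul0r.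
    by rewrite intS mulrDl mul1r -[_ * x]opprK; apply: DB => //; exact: DN.
  case: (intP z) => [|n|n]; [exact: Hn 0%N|exact: Hn|].
  by rewrite mulNr; apply: DN.
have Hex N : forall e, D e -> (0 < `|e| <= N)%N ->
    exists d, D d /\ forall x, D x -> (d %| x)%Z.
  elim: N => [|N IHN] e De; first by case: `|e|%N.
  move=> /andP[e0 eN].
  have [div_all|/existsNP[x /not_implyP[Dx /negP ndiv]]] :=
    EM (forall x, D x -> (e %| x)%Z); first by exists e.
  have ez : e != 0 by rewrite -absz_gt0.
  apply: (IHN (x %% e)%Z); first by rewrite /modz; apply: DB => //; exact: DM.
  apply/andP; split; first by rewrite absz_gt0; apply: contra ndiv => /eqP/dvdz_mod0P.
  rewrite -ltnS (leq_trans _ eN) // -ltz_nat gez0_abs ?modz_ge0 //.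
  exact: ltz_mod.
have [all0|/existsNP[x /not_implyP[Dx /eqP x0]]] := EM (forall x, D x -> x = 0).
  by exists 0; split=> // x /all0 ->.
by apply: (Hex `|x|%N x Dx); rewrite absz_gt0 x0 leqnn.
Qed.

(** The first coordinates of [L] form an ideal dZ. A vector [w] of [L] with first coordinate d,
    together with generators of the vectors of [L] with first coordinate 0, spans [L]. The rows of
    [M] may be dependent, which is why [M] can be taken square. *)
Lemma lattice_gen k (L : 'rV[int]_k -> Prop) :
  lattice L -> exists M : 'M[int]_k, forall v, L v <-> exists w, v = w *m M.
Proof.
elim: k L => [|k IHk] L HL.
  exists 0 => v; rewrite (thinmx0 v); split=> _; last exact: HL.1.
  by exists 0; rewrite mul0mx.
move: L HL; rewrite -[k.+1]/(1 + k)%N => L HL.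
have [||d [[w [Lw wd]] Hd]] :=
    @int_subgroup_principal (fun d => exists v, L v /\ v 0 0 = d).
- by exists 0; split; [exact: HL.1|rewrite mxE].
- move=> _ _ [v [Lv <-]] [w [Lw <-]]; exists (v - w).
  by split; [exact: HL.2|rewrite !mxE].
have [|M HM] := IHk (fun u => L (row_mx 0 u)).
  split=> [|u v Lu Lv]; first by rewrite row_mx0; exact: HL.1.
  by rewrite -[X in row_mx X](subr0 0) -add_row_mx -opp_row_mx; exact: HL.2.
exists (col_mx w (row_mx 0 M)) => v; split=> [Lv|[u ->]].
  have /dvdzP[q vq] : (d %| v 0%R 0%R)%Z by apply: Hd; exists v.
  have eqv : v - q *: w = row_mx 0 (rsubmx (v - q *: w)).
    rewrite -[LHS]hsubmxK; congr row_mx; apply/rowP => j.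
    have -> : j = 0 by exact: ord1.
    rewrite [LHS]mxE; have -> : lshift k (0 : 'I_1) = 0 :> 'I_(1 + k) by exact: val_inj.
    by rewrite !mxE vq wd subrr.
  have [u eu] : exists u, rsubmx (v - q *: w) = u *m M.
    by apply/HM; rewrite -eqv; apply: HL.2 => //; exact: latticeMz.
  exists (row_mx q%:M u); rewrite mul_row_col mul_scalar_mx mul_mx_row mulmx0 -eu.
  by rewrite -eqv addrC subrK.
rewrite -[u]hsubmxK mul_row_col mul_mx_row mulmx0.
apply: latticeD => //; last by apply/HM; eexists.
by rewrite [lsubmx u]mx11_scalar mul_scalar_mx; exact: latticeMz.
Qed.

(** Write generators of [L] as P D Q in Smith form. Purity lets every nonzero invariant factor be
    replaced by 1, so [L] is spanned by the first r rows of Q. [E] and [B] are the upper and lower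
    row blocks of Q, [F] and [A] the left and right column blocks of its inverse. Thus [A] presents
    Z^k/L as Z^s with section [B], and [F] gives coordinates on [L] in the basis [E]. *)
Lemma pure_lattice_split k (L : 'rV[int]_k -> Prop) :
  lattice L -> (forall v n, (0 < n)%N -> L (v *+ n) -> L v) ->
  exists r s, k = (r + s)%N /\
  exists (A : 'M[int]_(k, s)) (B : 'M[int]_(s, k))
         (E : 'M[int]_(r, k)) (F : 'M[int]_(k, r)),
    [/\ B *m A = 1%:M, E *m F = 1%:M, forall u, L (u *m E),
        forall v, L v <-> v *m A = 0
      & forall v : 'rV_k, v *m A = 0 -> v *m F = 0 -> v = 0].
Proof.
move=> HL pureL; have [M HM] := lattice_gen HL.
have [P uP [Q uQ [d dsort eqM]]] := int_Smith_normal_form M.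
pose D : 'M[int]_k := \matrix_(i, j) (d`_i *+ (i == j :> nat)).
have LD v : L v <-> exists w, v *m invmx Q = w *m D.
  rewrite HM; split=> [[w ->]|[w ew]].
    by exists (w *m P); rewrite eqM !mulmxA mulmxK.
  exists (w *m invmx P); rewrite eqM !mulmxA mulmxKV // -ew mulmxKV //.
have mulD (w : 'rV_k) i : (w *m D) 0 i = w 0 i * d`_i.
  rewrite mxE (bigD1 i) //= mxE eqxx mulr1n big1 ?addr0 // => j ji.
  by have /negbTE E : j != i :> nat := ji; rewrite mxE E mulr0.
(* Row i of Q times |d_i| lies in [L], so purity puts the row itself in [L]; the witness [sgz]
   corrects the sign of d_i. *)
have Ldelta (i : 'I_k) : d`_i != 0 -> L (delta_mx 0 i *m Q).
  move=> di; have nz : (0 < absz (nth 0%R d i))%N by rewrite absz_gt0.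
  apply: (pureL _ _ nz); apply/LD; exists (sgz d`_i *: delta_mx 0 i).
  apply/rowP => j; rewrite -scaler_nat -!scalemxAl mulmxK // [in RHS]mxE mulD !mxE eqxx /=.
  have [->|_] := eqVneq j i; last by rewrite mulr0 mul0r mulr0.
  by rewrite mul1r mulr1 natz abszE normrEsg.
(* The position of the first zero: in a divisibility chain only zeros follow a zero. Entries past
   the end of [d] default to 0, and the minimum with k covers a longer [d]. *)
have [r [rk rP]] : exists r, (r <= k)%N /\ forall i, (i < k)%N -> (d`_i != 0) = (i < r)%N.
  exists (minn k (find (pred1 0) d)); split; first exact: geq_minl.
  move=> i ik; rewrite leq_min ik /=; case: ltnP => [lt|le].
    by apply/negbT; have := before_find 0 lt.
  case: (ltnP i (size d)) => [isz|isz]; last by rewrite nth_default ?eqxx.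
  have hasz : has (pred1 0) d by rewrite has_find (leq_ltn_trans le).
  have dz : d`_(find (pred1 0) d) = 0 by apply/eqP; exact: (nth_find 0 hasz).
  have tr : transitive dvdz by move=> a b c; exact: dvdz_trans.
  have rfl : reflexive dvdz by exact: dvdzz.
  have := sorted_leq_nth tr rfl 0 dsort (find (pred1 0) d) i.
  rewrite dz !inE => /(_ (leq_ltn_trans le isz) isz le) dv.
  by apply/negbTE; rewrite negbK -dvd0z.
have [s ks] : exists s, k = (r + s)%N by exists (k - r)%N; rewrite subnKC.
subst k; exists r, s; split=> //.
have LQ v : L v <-> rsubmx (v *m invmx Q) = 0.
  split=> [/LD[w ->]|v0].
    apply/rowP => j; rewrite mxE mulD [RHS]mxE.
    have := rP (rshift r j) (ltn_ord _); rewrite /= ltnNge leq_addr /= => /negbT.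
    by rewrite negbK => /eqP ->; rewrite mulr0.
  rewrite -[v](mulmxKV uQ) -[v *m _]hsubmxK v0.
  rewrite -{2}[Q]vsubmxK mul_row_col mul0mx addr0 mulmx_sum_row.
  apply: lattice_sum => // i; apply: latticeMz => //.
  rewrite row_usubmx rowE; apply: Ldelta.
  by rewrite rP ?ltn_ord //= ltn_ord.
have mulR (v : 'rV_(r + s)) : v *m rsubmx (invmx Q) = rsubmx (v *m invmx Q).
  by rewrite -[in RHS](hsubmxK (invmx Q)) mul_mx_row row_mxKr.
have mulL (v : 'rV_(r + s)) : v *m lsubmx (invmx Q) = lsubmx (v *m invmx Q).
  by rewrite -[in RHS](hsubmxK (invmx Q)) mul_mx_row row_mxKl.
have := mulmxV uQ; rewrite -[X in X *m _]vsubmxK -[X in _ *m X]hsubmxK mul_col_row.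
rewrite scalar_mx_block => /eq_block_mx[EF EA _ BA].
exists (rsubmx (invmx Q)), (dsubmx Q), (usubmx Q), (lsubmx (invmx Q)).
split=> // [u|v|v].
- by rewrite LQ -mulR -mulmxA EA mulmx0.
- by rewrite mulR.
- rewrite mulR mulL => vR vL.
  by rewrite -[v](mulmxKV uQ) -[v *m _]hsubmxK vR vL row_mx0 mul0mx.
Qed.

(* The bound is read off over [rat]: [diag N = W *m X] has rank [k]. *)
Lemma finite_index_rowspan_bound k l (X : 'M[int]_(l, k)) :
  (forall v : 'rV[int]_k, exists n, (0 < n)%N /\ exists w, v *+ n = w *m X) ->
  (k <= l)%N.
Proof.
move=> HX.
have [N HN] := choice (fun i : 'I_k => HX (delta_mx 0 i)).
have [W HW] := choice (fun i => (HN i).2).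
pose D : 'M[int]_k := diag_mx (\row_i (N i)%:R).
have eqD : D = (\matrix_i W i) *m X.
  apply/row_matrixP => i; rewrite row_mul rowK -HW row_diag_mx mxE.
  by rewrite scaler_nat.
have : \rank (map_mx intr D : 'M[rat]_k) = k.
  apply: mxrank_unit; rewrite unitmxE det_map_mx det_diag unitfE intr_eq0.
  apply/prodf_neq0 => i _; rewrite mxE pnatr_eq0 -lt0n; exact: (HN i).1.
rewrite eqD map_mxM => <-.
by rewrite (leq_trans (mxrankM_maxr _ _)) ?rank_leq_row.
Qed.

(** * Words and subgroups *)

Lemma gmulxV (G : group) (x : G) : x ** ginv x = gone.
Proof.
by rewrite -(gmul1x _ (x ** ginv x)) -{1}(gmulVx _ (ginv x)) -gmulA
  (gmulA _ (ginv x) x) gmulVx gmul1x gmulVx.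
Qed.

Lemma gmulx1 (G : group) (x : G) : x ** gone = x.
Proof. by rewrite -(gmulVx _ x) gmulA gmulxV gmul1x. Qed.

Lemma gmulK (G : group) (x y : G) : x ** y ** ginv y = x.
Proof. by rewrite -gmulA gmulxV gmulx1. Qed.

Lemma gmulKV (G : group) (x y : G) : x ** ginv y ** y = x.
Proof. by rewrite -gmulA gmulVx gmulx1. Qed.

Lemma gmulI (G : group) (x y z : G) : x ** y = x ** z -> y = z.
Proof.
by move=> e; rewrite -(gmul1x _ y) -(gmul1x _ z) -(gmulVx _ x) -!gmulA e.
Qed.

Lemma ginvK (G : group) (x : G) : ginv (ginv x) = x.
Proof. by apply: (@gmulI _ (ginv x)); rewrite gmulxV gmulVx. Qed.

Lemma ginvM (G : group) (x y : G) : ginv (x ** y) = ginv y ** ginv x.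
Proof. by apply: (@gmulI _ (x ** y)); rewrite gmulxV gmulA gmulK gmulxV. Qed.

Lemma ginv1 (G : group) : ginv gone = gone :> G.
Proof. by apply: (@gmulI _ gone); rewrite gmulxV gmul1x. Qed.

Definition group_simp := (ginvM, ginvK, ginv1, gmulA, gmulVx, gmulxV, gmul1x, gmulx1,
  gmulK, gmulKV).

Lemma mulg_comm (G : group) (x y : G) : x ** y = y ** x ** comm x y.
Proof. by rewrite /comm !group_simp. Qed.

Lemma comm_unique (G : group) (x y z : G) : x ** y = y ** x ** z -> comm x y = z.
Proof. by rewrite mulg_comm; exact: gmulI. Qed.

Lemma commP (G : group) (x y : G) : comm x y = gone <-> x ** y = y ** x.
Proof.
split=> [e|e]; first by rewrite mulg_comm e gmulx1.
by apply: comm_unique; rewrite gmulx1 e.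
Qed.

Lemma ginv_comm (G : group) (x y : G) : ginv (comm x y) = comm y x.
Proof. by rewrite /comm !group_simp. Qed.

Lemma npowS (G : group) (x : G) n : npow x n.+1 = x ** npow x n.
Proof.
elim: n => [|n IHn]; first by rewrite /= gmul1x gmulx1.
by rewrite -[LHS]/(npow x n.+1 ** x) [in LHS]IHn -gmulA.
Qed.

(** Powers with exponents in [int], the ring over which the lattices live; [zpow_ipow] and
    [zpow_int] translate to [zpow]. *)
Definition ipow (G : group) (x : G) (z : int) : G :=
  if z is Negz n then ginv (npow x n.+1) else npow x (absz z).

Lemma ipowSr (G : group) (x : G) z : ipow x (z + 1) = ipow x z ** x.
Proof.
case: z => [n|[|n]]; first by rewrite -PoszD addn1.
  by rewrite /= gmul1x gmulVx.
have -> : Negz n.+1 + 1 = Negz n by lia.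
by rewrite /ipow [npow x n.+2]npowS ginvM gmulKV.
Qed.

Lemma ipowD (G : group) (x : G) z w : ipow x (z + w) = ipow x z ** ipow x w.
Proof.
have ipowBr y : ipow x (y - 1) = ipow x y ** ginv x.
  by rewrite -{2}[y](subrK 1) ipowSr gmulK.
elim/int_rect: w => [|n IHn|n IHn]; first by rewrite addr0 gmulx1.
  by rewrite intS [1 + _]addrC addrA !ipowSr IHn gmulA.
by rewrite intS opprD [- 1 + _]addrC addrA !ipowBr IHn gmulA.
Qed.

Lemma zpow_ipow (G : group) (x : G) z : zpow x (ssrZ.Z_of_int z) = ipow x z.
Proof.
rewrite /zpow; case: z => n.
  by rewrite (_ : Z.leb 0 _ = true) /=; [rewrite Nat2Z.id|lia].
rewrite (_ : Z.leb 0 _ = false); last by lia.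
by rewrite /ipow; congr (ginv (npow x _)); lia.
Qed.

Definition subgroup (G : group) (S : G -> Prop) : Prop :=
  [/\ S gone, forall x y, S x -> S y -> S (x ** y) & forall x, S x -> S (ginv x)].

Lemma subgroup_gen (G : group) (X : G -> Prop) : subgroup (gen X).
Proof. by split; [exact: gen_one|exact: gen_mul|exact: gen_inv]. Qed.

Lemma gen_sub (G : group) (X S : G -> Prop) :
  subgroup S -> (forall x, X x -> S x) -> forall x, gen X x -> S x.
Proof. by move=> [S1 SM SV] XS x; elim=> //; auto. Qed.

Lemma gen_mono (G : group) (X Y : G -> Prop) :
  (forall x, X x -> Y x) -> forall x, gen X x -> gen Y x.
Proof. by move=> XY; apply: gen_sub; [exact: subgroup_gen|auto using gen_base]. Qed.

Lemma subgroup_npow (G : group) (S : G -> Prop) x n :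
  subgroup S -> S x -> S (npow x n).
Proof. by move=> [S1 SM _] Sx; elim: n => //= n IHn; exact: SM. Qed.

Lemma subgroup_ipow (G : group) (S : G -> Prop) x z :
  subgroup S -> S x -> S (ipow x z).
Proof.
move=> HS Sx; case: z => n; first exact: subgroup_npow.
by case: (HS) => _ _; apply; exact: subgroup_npow.
Qed.

Lemma subgroup_prod (G : group) (S : G -> Prop) k f :
  subgroup S -> (forall i, (i < k)%N -> S (f i)) -> S (prod_upto G k f).
Proof.
move=> HS; elim: k => [|k IHk] Hf; first by case: HS.
case: (HS) => _ SM _; apply: SM; last exact: Hf.
by apply: IHk => i ik; apply: Hf; exact: ltnW.
Qed.

Lemma subgroup_center (G : group) : subgroup (@in_center G).
Proof.
split=> [y|x y Zx Zy z|x Zx y]; first by rewrite gmul1x gmulx1.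
  by rewrite -gmulA Zy gmulA Zx gmulA.
by apply: (@gmulI _ x); rewrite !group_simp Zx gmulK.
Qed.

Lemma subgroup_full (G : group) : subgroup (fun _ : G => True).
Proof. by []. Qed.

Lemma subgroup_triv (G : group) : subgroup (@eq G gone).
Proof. by split=> [//|x y <- <-|x <-]; rewrite ?gmul1x ?ginv1. Qed.

(** Additivity is required on [T] only: the coordinates of a central subgroup come from functions on
    the whole group that need not be homomorphisms there. *)
Definition additive_on (G : group) (T : G -> Prop) (V : zmodType) (f : G -> V) :=
  forall x y, T x -> T y -> f (x ** y) = f x + f y.

Lemma additive_on1 (G : group) (T : G -> Prop) (V : zmodType) (f : G -> V) :
  subgroup T -> additive_on T f -> f gone = 0.
Proof.
move=> [T1 _ _] Hf; apply: (@addrI _ (f gone)).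
by rewrite -Hf // gmul1x addr0.
Qed.

Lemma additive_onV (G : group) (T : G -> Prop) (V : zmodType) (f : G -> V) x :
  subgroup T -> additive_on T f -> T x -> f (ginv x) = - f x.
Proof.
move=> HT Hf Tx; have [_ _ TV] := HT; apply: (@addrI _ (f x)).
by rewrite -Hf ?gmulxV ?subrr ?(additive_on1 HT) //; exact: TV.
Qed.

Lemma additive_on_npow (G : group) (T : G -> Prop) (V : zmodType) (f : G -> V) x n :
  subgroup T -> additive_on T f -> T x -> f (npow x n) = f x *+ n.
Proof.
move=> HT Hf Tx; elim: n => [|n IHn]; first exact: additive_on1 HT Hf.
by rewrite /= Hf ?IHn ?mulrSr //; exact: subgroup_npow.
Qed.

Lemma additive_on_ipow (G : group) (T : G -> Prop) (V : zmodType) (f : G -> V) x z :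
  subgroup T -> additive_on T f -> T x -> f (ipow x z) = f x *~ z.
Proof.
move=> HT Hf Tx; case: z => n; first exact: additive_on_npow HT Hf Tx.
rewrite NegzE mulrNz -pmulrn -(additive_on_npow _ HT Hf Tx).
by apply: (additive_onV HT Hf); exact: subgroup_npow.
Qed.

Lemma additive_on_prod (G : group) (T : G -> Prop) (V : zmodType) (f : G -> V) k x :
  subgroup T -> additive_on T f -> (forall i, (i < k)%N -> T (x i)) ->
  f (prod_upto G k x) = \sum_(i < k) f (x i).
Proof.
move=> HT Hf; elim: k => [|k IHk] Tx; first by rewrite big_ord0; exact: additive_on1 HT Hf.
have Tx' i : (i < k)%N -> T (x i) by move=> ik; apply: Tx; exact: ltnW.
by rewrite /= Hf ?big_ord_recr ?IHk //; [exact: subgroup_prod|exact: Tx].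
Qed.

(** * Abelian subquotients *)

(* The quotient T/S makes sense and is abelian; quotients are handled through
   representatives, without quotient types. *)
Definition abquo (G : group) (T S : G -> Prop) : Prop :=
  [/\ subgroup T, subgroup S, forall x, S x -> T x
    & forall x y, T x -> T y -> S (comm x y)].

Definition eqmod (G : group) (S : G -> Prop) (x y : G) : Prop := S (ginv x ** y).

Lemma eqmod_refl (G : group) (S : G -> Prop) x : subgroup S -> eqmod S x x.
Proof. by case=> S1 _ _; rewrite /eqmod gmulVx. Qed.

Lemma eqmod_sym (G : group) (S : G -> Prop) x y :
  subgroup S -> eqmod S x y -> eqmod S y x.
Proof. by move=> [_ _ SV] /SV; rewrite /eqmod !group_simp. Qed.

Lemma eqmod_trans (G : group) (S : G -> Prop) y x z :
  subgroup S -> eqmod S x y -> eqmod S y z -> eqmod S x z.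
Proof. by move=> [_ SM _] xy yz; have := SM _ _ xy yz; rewrite /eqmod !group_simp. Qed.

Lemma eqmod_mem (G : group) (S U : G -> Prop) x y :
  subgroup U -> (forall z, S z -> U z) -> eqmod S x y -> U x <-> U y.
Proof.
move=> [_ UM UV] SU /SU xy; split=> [Ux|Uy].
  by have := UM _ _ Ux xy; rewrite !group_simp.
by have := UM _ _ Uy (UV _ xy); rewrite !group_simp.
Qed.

Lemma eqmodMl (G : group) (S : G -> Prop) x y z :
  eqmod S x y -> eqmod S (z ** x) (z ** y).
Proof. by rewrite /eqmod !group_simp. Qed.

(** [S] is normal in [T], since the conjugate of s by z is s [s,z] and commutators of [T] lie in
    [S]. *)
Lemma abquo_conj (G : group) (T S : G -> Prop) s z :
  abquo T S -> T z -> S s -> S (ginv z ** s ** z).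
Proof.
move=> [_ [_ SM _] ST TS] Tz Ss; have := SM _ _ Ss (TS _ _ (ST _ Ss) Tz).
by rewrite /comm !group_simp.
Qed.

Lemma eqmodMr (G : group) (T S : G -> Prop) x y z :
  abquo T S -> T z -> eqmod S x y -> eqmod S (x ** z) (y ** z).
Proof.
by move=> HTS Tz /(abquo_conj HTS Tz); rewrite /eqmod !group_simp.
Qed.

Lemma eqmodC (G : group) (T S : G -> Prop) x y :
  abquo T S -> T x -> T y -> eqmod S (x ** y) (y ** x).
Proof. by move=> [_ _ _ TS] Tx Ty; have := TS _ _ Ty Tx; rewrite /eqmod /comm !group_simp. Qed.

(** Extended by 0 to all natural indices, because [prod_upto] runs over [nat]. *)
Definition coef k (v : 'rV[int]_k) (i : nat) : int := oapp (v 0) 0 (insub i).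

Lemma coef_ord k (v : 'rV[int]_k) (i : 'I_k) : coef v i = v 0 i.
Proof. by rewrite /coef valK. Qed.

Lemma coefD k (v w : 'rV[int]_k) i : coef (v + w) i = coef v i + coef w i.
Proof. by rewrite /coef; case: insub => [j|] /=; rewrite ?mxE ?addr0. Qed.

Lemma coef_delta k (i : 'I_k) (j : nat) : coef (delta_mx 0 i) j = (j == i)%:R.
Proof.
rewrite /coef; case: insubP => [j' _ <-|]; first by rewrite /= mxE.
by rewrite /=; case: eqP => [->|//]; rewrite ltn_ord.
Qed.

Definition wprod (G : group) k (x : nat -> G) (v : 'rV[int]_k) : G :=
  prod_upto G k (fun i => ipow (x i) (coef v i)).

Lemma wprod_mem (G : group) (T : G -> Prop) k (x : nat -> G) (v : 'rV[int]_k) :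
  subgroup T -> (forall i, (i < k)%N -> T (x i)) -> T (wprod x v).
Proof.
by move=> HT Tx; apply: subgroup_prod => // i ik; apply: subgroup_ipow => //; exact: Tx.
Qed.

Lemma prod_upto_single (G : group) (f : nat -> G) j k :
  (forall i, i != j -> f i = gone) ->
  prod_upto G k f = if (j < k)%N then f j else gone.
Proof.
move=> Hf; elim: k => [//|k IHk] /=; rewrite IHk ltnS.
case: (ltngtP j k) => [jk|kj|->]; rewrite ?gmul1x //.
  by rewrite (Hf k) ?gmulx1 // neq_ltn jk orbT.
by rewrite Hf // neq_ltn kj.
Qed.

Lemma wprod_delta (G : group) k (x : nat -> G) (i : 'I_k) :
  wprod x (delta_mx 0 i) = x i.
Proof.
rewrite /wprod (@prod_upto_single _ _ i) ?ltn_ord.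
  by rewrite coef_delta eqxx /= gmul1x.
by move=> j /negbTE ji; rewrite coef_delta ji.
Qed.

Lemma wprodD (G : group) (T S : G -> Prop) k (x : nat -> G) (v w : 'rV[int]_k) :
  abquo T S -> (forall i, (i < k)%N -> T (x i)) ->
  eqmod S (wprod x (v + w)) (wprod x v ** wprod x w).
Proof.
move=> HTS; have [HT HS _ _] := HTS; have [_ TM _] := HT; rewrite /wprod.
(* The induction is on the length l of the product, while the exponent vectors keep their dimension
   k. *)
suff H l : (forall i, (i < l)%N -> T (x i)) ->
    eqmod S (prod_upto G l (fun i => ipow (x i) (coef (v + w) i)))
      (prod_upto G l (fun i => ipow (x i) (coef v i)) **
       prod_upto G l (fun i => ipow (x i) (coef w i))) by exact: H.
elim: l => [|l IHl] Tx /=; first by rewrite gmul1x; exact: eqmod_refl.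
have Tx' i : (i < l)%N -> T (x i) by move=> il; apply: Tx; exact: ltnW.
have Tp u : T (ipow (x l) (coef u l)) by apply: subgroup_ipow => //; exact: Tx.
have Tq (u : 'rV_k) : T (prod_upto G l (fun i => ipow (x i) (coef u i))).
  by apply: subgroup_prod => // i il; apply: subgroup_ipow => //; exact: Tx'.
rewrite coefD ipowD.
apply: eqmod_trans (eqmodMr HTS _ (IHl Tx')) _ => //; first exact: TM.
rewrite -!gmulA; apply: eqmodMl; rewrite !gmulA.
by apply: (eqmodMr HTS) => //; apply: (eqmodC HTS).
Qed.

(* f induces a homomorphism Z^k -> T/S. *)
Definition quohom (G : group) (T S : G -> Prop) k (f : 'rV[int]_k -> G) : Prop :=
  (forall v, T (f v)) /\ forall v w, eqmod S (f (v + w)) (f v ** f w).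

Lemma quohom_wprod (G : group) (T S : G -> Prop) k (x : nat -> G) :
  abquo T S -> (forall i, (i < k)%N -> T (x i)) ->
  quohom T S (fun v : 'rV_k => wprod x v).
Proof.
move=> HTS Tx; split=> [v|v w]; last exact: wprodD HTS Tx.
by case: HTS => HT _ _ _; exact: wprod_mem.
Qed.

Lemma quohom0 (G : group) (T S : G -> Prop) k (f : 'rV[int]_k -> G) :
  quohom T S f -> S (f 0).
Proof. by move=> [_ /(_ 0 0)]; rewrite /eqmod addr0 !group_simp. Qed.

Lemma quohomB (G : group) (T S : G -> Prop) k (f : 'rV[int]_k -> G) v w :
  abquo T S -> quohom T S f -> eqmod S (f (v - w)) (f v ** ginv (f w)).
Proof.
move=> HTS [Tf fD]; have [[_ _ TV] HS _ _] := HTS.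
apply: eqmod_sym => //; have := fD (v - w) w; rewrite subrK.
by move/(eqmodMr HTS (TV _ (Tf w))); rewrite gmulK.
Qed.

Lemma quohomMn (G : group) (T S : G -> Prop) k (f : 'rV[int]_k -> G) v n :
  abquo T S -> quohom T S f -> eqmod S (f (v *+ n)) (npow (f v) n).
Proof.
move=> HTS Hf; have [Tf fD] := Hf; have [_ HS _ _] := HTS.
elim: n => [|n IHn]; first by have [_ _ SV] := HS; rewrite /eqmod gmulx1; apply: SV; exact: quohom0 Hf.
rewrite mulrSr; apply: eqmod_trans (fD _ _) _ => //=.
by apply: (eqmodMr HTS).
Qed.

Lemma quohom_lattice (G : group) (T S U : G -> Prop) k (f : 'rV[int]_k -> G) :
  abquo T S -> quohom T S f -> subgroup U -> (forall x, S x -> U x) ->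
  lattice (fun v => U (f v)).
Proof.
move=> HTS Hf HU SU; split=> [|v w Uv Uw]; first by apply: SU; exact: quohom0 Hf.
by apply/(eqmod_mem HU SU (quohomB v w HTS Hf)); have [_ UM UV] := HU; auto.
Qed.

(** One notion for both ranks of the theorem: a trivial [S] gives [sub_gen_by], and [T] = G with [S]
    = Z(G) gives [quot_center_gen_by]. *)
Definition relgen (G : group) (T S : G -> Prop) (k : nat) : Prop :=
  exists x : nat -> G, (forall i, (i < k)%N -> T (x i)) /\
    forall g, T g -> gen (fun y => fam G k x y \/ S y) g.

Lemma gen_wprod (G : group) (T S : G -> Prop) k (x : nat -> G) g :
  abquo T S -> (forall i, (i < k)%N -> T (x i)) ->
  gen (fun y => fam G k x y \/ S y) g -> exists v : 'rV_k, eqmod S (wprod x v) g.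
Proof.
move=> HTS Tx; have [HT HS ST _] := HTS; have [T1 TM TV] := HT.
have Hf := quohom_wprod HTS Tx; have [Tf fD] := Hf.
(* Membership in [T] is carried through the induction because the inverse case conjugates by y. *)
suff H : gen (fun y => fam G k x y \/ S y) g ->
    T g /\ exists v : 'rV_k, eqmod S (wprod x v) g by case/H.
elim=> {g} [y [[i [/ssrnat.ltP ik ->]]|Sy]||y z _ [Ty [v yv]] _ [Tz [w zw]]|y _ [Ty [v yv]]].
- split; first exact: Tx.
  by exists (delta_mx 0 (Ordinal ik)); rewrite wprod_delta; exact: eqmod_refl.
- split; first exact: ST.
  exists 0; have [_ SM SV] := HS; apply: SM => //; apply: SV; exact: quohom0 Hf.
- split=> //; exists 0; have [_ SM SV] := HS; rewrite /eqmod gmulx1.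
  by apply: SV; exact: quohom0 Hf.
- split; first exact: TM.
  exists (v + w); apply: eqmod_trans (fD v w) _ => //.
  by apply: eqmod_trans (eqmodMr HTS (Tf w) yv) (eqmodMl _ zw).
- split; first exact: TV.
  exists (0 - v); apply: eqmod_trans (quohomB _ _ HTS Hf) _ => //.
  have [S1 SM SV] := HS.
  apply: (@eqmod_trans _ _ (ginv (wprod x v))) => //.
    rewrite -{2}(gmul1x _ (ginv _)); apply: (eqmodMr HTS); first exact: TV.
    by rewrite /eqmod gmulx1; apply: SV; exact: quohom0 Hf.
  have := abquo_conj HTS (TV _ Ty) (SV _ yv).
  by rewrite /eqmod !group_simp.
Qed.

Lemma relgen_quohom (G : group) (T S : G -> Prop) k :
  abquo T S -> relgen T S k ->
  exists f : 'rV[int]_k -> G, quohom T S f /\ forall g, T g -> exists v, eqmod S (f v) g.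
Proof.
move=> HTS [x [Tx Hx]]; exists (fun v => wprod x v); split; first exact: quohom_wprod.
by move=> g /Hx; apply: gen_wprod HTS Tx.
Qed.

(* T/S is free abelian of rank k; the quotient map p is junk outside T. *)
Definition relfree (G : group) (T S : G -> Prop) (k : nat) : Prop :=
  exists p : G -> 'rV[int]_k, [/\ additive_on T p,
    forall v, exists t, T t /\ p t = v & forall t, T t -> p t = 0 <-> S t].

Definition pure_in (G : group) (T S : G -> Prop) : Prop :=
  forall x n, T x -> (0 < n)%N -> S (npow x n) -> S x.

(** Generators give a surjection from Z^k to T/S. Its kernel is a pure lattice since T/S is
    torsion-free, so Z^k modulo the kernel is free; the coordinates of g are those of any
    preimage. *)
Lemma relgen_relfree (G : group) (T S : G -> Prop) k :
  abquo T S -> pure_in T S -> relgen T S k -> exists r, (r <= k)%N /\ relfree T S r.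
Proof.
move=> HTS pureS /(relgen_quohom HTS)[f [Hf onto_f]].
have [HT HS ST _] := HTS; have [Tf fD] := Hf; have [_ TM TV] := HT.
have latL := quohom_lattice HTS Hf HS (fun x Sx => Sx).
have pureL v n : (0 < n)%N -> S (f (v *+ n)) -> S (f v).
  move=> n0 /(eqmod_mem HS (fun x Sx => Sx) (quohomMn v n HTS Hf)).
  exact: pureS.
have [r [s [ek [A [B [E [F [BA _ _ LA _]]]]]]]] := pure_lattice_split latL pureL.
(* Guarding by [T g] makes the choice function total; outside [T] it takes a junk value. *)
have Hex g : exists v, T g -> eqmod S (f v) g.
  by have [/onto_f[v]|nT] := EM (T g); [exists v|exists 0].
have [c Hc] := choice Hex.
(* Coordinates do not depend on the chosen preimage: two preimages differ by a vector of the kernel,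
   which [A] kills. *)
have Hker v w : eqmod S (f v) (f w) -> v *m A = w *m A.
  move=> vw; apply/eqP; rewrite -subr_eq0 -mulmxBl; apply/eqP/LA.
  apply/(eqmod_mem HS (fun x Sx => Sx) (quohomB v w HTS Hf)).
  have [_ _ SV] := HS; have := abquo_conj HTS (TV _ (Tf v)) (SV _ vw).
  by have := abquo_conj HTS (TV _ (Tf w)) vw; rewrite !group_simp.
exists s; split; first by rewrite ek leq_addl.
exists (fun g => c g *m A); split.
- move=> g h Tg Th; rewrite -mulmxDl; apply: Hker.
  apply: eqmod_trans (Hc _ (TM _ _ Tg Th)) _ => //; apply: eqmod_sym => //.
  apply: eqmod_trans (fD _ _) _ => //.
  by apply: eqmod_trans (eqmodMr HTS (Tf _) (Hc g Tg)) (eqmodMl _ (Hc h Th)).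
- move=> v; exists (f (v *m B)); split; first exact: Tf.
  by rewrite (Hker _ _ (Hc _ (Tf _))) -mulmxA BA mulmx1.
- move=> t Tt; rewrite -LA; exact: (eqmod_mem HS (fun x Sx => Sx) (Hc t Tt)).
Qed.

(** Indexed by [nat] to match the families [nat -> G]; it vanishes for i >= k. *)
Definition unitv k (i : nat) : 'rV[int]_k := \row_j (i == j :> nat)%:R.

Lemma unitv_delta k (i : 'I_k) : unitv k i = delta_mx 0 i.
Proof. by apply/rowP => j; rewrite !mxE eqxx eq_sym. Qed.

Lemma row_sum_unitv k (v : 'rV[int]_k) : \sum_(i < k) unitv k i *~ coef v i = v.
Proof.
rewrite [RHS]row_sum_delta; apply: eq_bigr => i _.
by rewrite unitv_delta coef_ord -scaler_int intz.
Qed.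

Lemma additive_on_wprod (G : group) (T : G -> Prop) k (p : G -> 'rV[int]_k) x v :
  subgroup T -> additive_on T p ->
  (forall i, (i < k)%N -> T (x i) /\ p (x i) = unitv k i) -> p (wprod x v) = v.
Proof.
move=> HT Hp Hx; have Tx i ik := (Hx i ik).1.
rewrite (additive_on_prod HT Hp) => [|i ik]; last by apply: subgroup_ipow => //; exact: Tx.
rewrite -[RHS]row_sum_unitv; apply: eq_bigr => i _.
by rewrite (additive_on_ipow _ HT Hp) ?(Hx i _).2 //; exact: Tx.
Qed.

Lemma relfree_basis (G : group) (T : G -> Prop) k (p : G -> 'rV[int]_k) :
  (forall v, exists t, T t /\ p t = v) ->
  exists x : nat -> G, forall i, T (x i) /\ p (x i) = unitv k i.
Proof. by move=> onto_p; have [x Hx] := choice (fun i => onto_p (unitv k i)); exists x. Qed.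

Lemma additive_on_eq (G : group) (T S : G -> Prop) k (p : G -> 'rV[int]_k) x y :
  subgroup T -> additive_on T p -> (forall t, T t -> p t = 0 <-> S t) ->
  T x -> T y -> p x = p y -> S (ginv x ** y).
Proof.
move=> HT Hp ker_p Tx Ty xy; have [_ TM TV] := HT; apply/ker_p; first by auto.
by rewrite Hp ?(additive_onV HT Hp) ?xy ?addNr //; exact: TV.
Qed.

Lemma relfree_relgen (G : group) (T S : G -> Prop) k :
  subgroup T -> relfree T S k -> relgen T S k.
Proof.
move=> HT [p [Hp onto_p ker_p]]; have [x Hx] := relfree_basis onto_p.
exists x; split=> [i _|t Tt]; first exact: (Hx i).1.
have HU := subgroup_gen (fun y => fam G k x y \/ S y); have [_ UM _] := HU.
have Tw v : T (wprod x v : G) by apply: wprod_mem => // i _; exact: (Hx i).1.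
have St : S (ginv (wprod x (p t)) ** t).
  apply: (additive_on_eq HT Hp ker_p) => //.
  by apply: (additive_on_wprod _ HT Hp).
rewrite -[t](gmul1x _) -(gmulxV (wprod x (p t))) -gmulA; apply: UM.
  apply: wprod_mem => // i ik; apply: gen_base; left; exists i; split=> //.
  exact/ssrnat.ltP.
by apply: gen_base; right.
Qed.

(** The image of [U] in Z^k is a pure lattice, hence a direct summand; the quotient coordinates [A]
    describe T/U and the coordinates [F] on the lattice describe U/S. *)
Lemma relfree_split (G : group) (T U S : G -> Prop) k :
  subgroup T -> subgroup U -> (forall x, S x -> U x) -> (forall x, U x -> T x) ->
  pure_in T U -> relfree T S k ->
  exists r s, [/\ k = (r + s)%N, relfree T U s & relfree U S r].
Proof.
move=> HT HU SU UT pureU [p [Hp onto_p ker_p]].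
have [T1 TM TV] := HT; have [U1 UM UV] := HU.
pose L v := exists u, U u /\ p u = v.
(* [U] is the full preimage of its image, since it contains the kernel [S] of [p]. *)
have UL t : T t -> U t <-> L (p t).
  move=> Tt; split=> [Ut|[u [Uu pu]]]; first by exists t.
  have Su := additive_on_eq HT Hp ker_p (UT _ Uu) Tt pu.
  by have := UM _ _ Uu (SU _ Su); rewrite !group_simp.
have latL : lattice L.
  split=> [|_ _ [u [Uu <-]] [w [Uw <-]]].
    by exists gone; split=> //; exact: additive_on1 HT Hp.
  exists (u ** ginv w); split; first by auto.
  by rewrite Hp ?(additive_onV HT Hp) //; auto.
have pureL v n : (0 < n)%N -> L (v *+ n) -> L v.
  have [t [Tt <-]] := onto_p v => n0; rewrite -(additive_on_npow _ HT Hp) //.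
  move/UL => Un; apply/UL => //; apply: (pureU _ n) => //.
  by apply: Un; exact: subgroup_npow.
have [r [s [ek [A [B [E [F [BA EF LE LA AF]]]]]]]] := pure_lattice_split latL pureL.
exists r, s; split=> //.
- exists (fun g => p g *m A); split=> [x y Tx Ty|v|t Tt].
  + by rewrite Hp // mulmxDl.
  + have [t [Tt pt]] := onto_p (v *m B).
    by exists t; rewrite pt -mulmxA BA mulmx1.
  + by rewrite UL // LA.
- exists (fun g => p g *m F); split=> [x y Ux Uy|v|t Ut].
  + by rewrite Hp ?mulmxDl; auto.
  + have [u [Uu pu]] := LE v.
    by exists u; rewrite pu -mulmxA EF mulmx1.
  + rewrite -ker_p; last exact: UT.
    split=> [ptF|->]; last by rewrite mul0mx.
    by apply: AF => //; apply/LA/UL => //; exact: UT.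
Qed.

(** Every vector of Z^k has a positive multiple in the span of the images of the l generators. With
    [U] = [T] this makes the rank well defined; with [U] = G' and [T] its isolator it bounds the
    rank of the isolator. *)
Lemma relfree_le_relgen (G : group) (T U S : G -> Prop) k l :
  subgroup T -> (forall x, S x -> T x) -> (forall x, U x -> T x) ->
  (forall t, T t -> exists n, (0 < n)%N /\ U (npow t n)) ->
  relfree T S k -> relgen U S l -> (k <= l)%N.
Proof.
move=> HT ST UT finU [p [Hp onto_p ker_p]] [x [Ux Hx]].
pose X := \matrix_(i < l) p (x i).
have [T1 TM TV] := HT.
have span g : gen (fun y => fam G l x y \/ S y) g -> T g /\ exists w, p g = w *m X.
  elim=> {g} [y [[i [/ssrnat.ltP il ->]]|Sy]||y z _ [Ty [v yv]] _ [Tz [w zw]]|y _ [Ty [v yv]]].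
  - split; first by apply: UT; exact: Ux.
    by exists (delta_mx 0 (Ordinal il)); rewrite -rowE rowK.
  - have Ty := ST _ Sy; split=> //; exists 0; rewrite mul0mx; exact/ker_p.
  - by split=> //; exists 0; rewrite mul0mx (additive_on1 HT Hp).
  - by split; [exact: TM|exists (v + w); rewrite Hp // yv zw mulmxDl].
  - by split; [exact: TV|exists (- v); rewrite (additive_onV HT Hp) // yv mulNmx].
apply: (@finite_index_rowspan_bound _ _ X) => v.
have [t [Tt <-]] := onto_p v; have [n [n0 Un]] := finU t Tt.
exists n; split=> //; rewrite -(additive_on_npow n HT Hp Tt).
by case: (span _ (Hx _ Un)).
Qed.

Lemma relfree_unique (G : group) (T S : G -> Prop) k l :
  subgroup T -> (forall x, S x -> T x) -> relfree T S k -> relfree T S l -> k = l.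
Proof.
move=> HT ST Fk Fl; have self t : T t -> exists n, (0 < n)%N /\ T (npow t n).
  by move=> Tt; exists 1%N; rewrite /= gmul1x.
apply/eqP; rewrite eqn_leq; apply/andP.
by split; apply: (relfree_le_relgen HT ST _ self) => //; exact: relfree_relgen.
Qed.

Lemma relgen_trans (G : group) (T U S : G -> Prop) k l :
  (forall x, U x -> T x) -> relgen T U k -> relgen U S l -> relgen T S (k + l).
Proof.
move=> UT [x [Tx Hx]] [y [Uy Hy]].
exists (fun i => if (i < k)%N then x i else y (i - k)%N); split=> [i ikl|t /Hx].
  case: ltnP => ik; first exact: Tx.
  by apply/UT/Uy; rewrite ltn_subLR.
set z := fun i : nat => _; apply: gen_sub; first exact: subgroup_gen.
move=> g [[i [/ssrnat.ltP ik ->]]|/Hy].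
  apply: gen_base; left; exists i; rewrite /z ik; split=> //.
  by apply/ssrnat.ltP; rewrite ltn_addr.
apply: gen_mono => h [[i [/ssrnat.ltP il ->]]|Sh]; last by right.
left; exists (k + i)%N; rewrite /z ltnNge leq_addr addKn; split=> //.
by apply/ssrnat.ltP; rewrite ltn_add2l.
Qed.

(** The preimage of [U] in Z^k is a lattice, hence spanned by k rows, whose images generate U/S. *)
Lemma relgen_subgroup (G : group) (T U S : G -> Prop) k :
  abquo T S -> subgroup U -> (forall x, S x -> U x) -> (forall x, U x -> T x) ->
  relgen T S k -> relgen U S k.
Proof.
move=> HTS HU SU UT /(relgen_quohom HTS)[f [Hf onto_f]].
have [M HM] := lattice_gen (quohom_lattice HTS Hf HU SU).
exists (fun i => f (unitv k i *m M)); split=> [i _|u Uu]; first by apply/HM; eexists.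
set X := fun y => _; have HX := subgroup_gen X.
have SX x : S x -> gen X x by move=> Sx; apply: gen_base; right.
have HfM : quohom T S (fun w => f (w *m M)).
  by split=> [w|v w]; [exact: Hf.1|rewrite mulmxDl; exact: Hf.2].
have [v vu] := onto_f u (UT _ Uu); apply/(eqmod_mem HX SX vu).
have [w ->] : exists w, v = w *m M by apply/HM/(eqmod_mem HU SU vu).
(* The good vectors [w] form a lattice, so it is enough to treat unit vectors, whose images are the
   chosen generators. *)
apply: (@lattice_full _ (fun w => gen X (f (w *m M)))).
  exact: quohom_lattice HTS HfM HX SX.
move=> i; apply: gen_base; left; exists i; rewrite unitv_delta; split=> //.
exact/ssrnat.ltP.
Qed.

Lemma relfree_pure (G : group) (T U : G -> Prop) k :
  subgroup T -> subgroup U -> relfree T U k -> pure_in T U.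
Proof.
move=> HT HU [p [Hp _ ker_p]] x n Tx n0.
move/ker_p => /(_ (subgroup_npow n HT Tx)); rewrite (additive_on_npow n HT Hp Tx).
move=> e; apply/ker_p => //; apply/rowP => i; move/rowP: e => /(_ i).
by rewrite mulmxnE mxE => /eqP; rewrite mulrn_eq0 eqn0Ngt n0 => /eqP.
Qed.

(** No coordinates are glued together: T/S is torsion-free and finitely generated, hence free of
    some rank, and splitting along [U] with uniqueness of ranks shows that this rank is k + l. *)
Lemma relfree_ext (G : group) (T U S : G -> Prop) k l :
  abquo T S -> subgroup U -> (forall x, S x -> U x) -> (forall x, U x -> T x) ->
  relfree T U k -> relfree U S l -> relfree T S (k + l).
Proof.
move=> HTS HU SU UT FTU FUS; have [HT HS ST _] := HTS.
have pureTU := relfree_pure HT HU FTU; have pureUS := relfree_pure HU HS FUS.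
have pureTS : pure_in T S.
  by move=> x n Tx n0 Sn; apply: (pureUS _ n) => //; apply: (pureTU _ n) => //; exact: SU.
have gTS : relgen T S (k + l).
  by apply: relgen_trans UT _ _; exact: relfree_relgen.
have [m [_ FTS]] := relgen_relfree HTS pureTS gTS.
have [r [s [em FTU' FUS']]] := relfree_split HT HU SU UT pureTU FTS.
rewrite (relfree_unique HT UT FTU FTU') (relfree_unique HU SU FUS FUS').
by rewrite addnC -em.
Qed.

(** * Minimal numbers of generators and the ranks of the theorem *)

Definition relrank (G : group) (T S : G -> Prop) (r : nat) : Prop :=
  relgen T S r /\ forall k, relgen T S k -> (r <= k)%N.

Lemma relfree_relrank (G : group) (T S : G -> Prop) k :
  subgroup T -> (forall x, S x -> T x) -> relfree T S k -> relrank T S k.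
Proof.
move=> HT ST FT; split=> [|l]; first exact: relfree_relgen.
apply: (relfree_le_relgen HT ST _ _ FT) => // t Tt; exists 1%N.
by rewrite /= gmul1x.
Qed.

Lemma relrank_relfree (G : group) (T S : G -> Prop) k :
  abquo T S -> pure_in T S -> relrank T S k -> relfree T S k.
Proof.
move=> HTS pureS [gT min_k]; have [r [rk FT]] := relgen_relfree HTS pureS gT.
have [HT _ _ _] := HTS; suff -> : k = r by [].
by apply/eqP; rewrite eqn_leq rk andbT; apply: min_k; exact: relfree_relgen.
Qed.

Lemma sub_gen_by_relgen (G : group) (T : G -> Prop) k :
  subgroup T -> sub_gen_by G T k <-> relgen T (@eq G gone) k.
Proof.
move=> HT; split=> [[x [Tx Hx]]|[x [Tx Hx]]]; exists x; split=> [i ik|g].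
- by apply: Tx; apply/ssrnat.ltP.
- by move/Hx; apply: gen_mono => y; left.
- by apply: Tx; apply/ssrnat.ltP.
split=> [/Hx|]; apply: gen_sub; [exact: subgroup_gen|..|exact: HT|].
  by move=> y [|<-]; [exact: gen_base|exact: gen_one].
by move=> _ [i [/ssrnat.ltP ik ->]]; exact: Tx.
Qed.

Lemma sub_rank_relrank (G : group) (T : G -> Prop) r :
  subgroup T -> sub_rank G T r <-> relrank T (@eq G gone) r.
Proof.
move=> HT; split=> -[/(sub_gen_by_relgen _ HT) gr min_r]; split=> //.
  by move=> k /(sub_gen_by_relgen _ HT)/min_r/ssrnat.leP.
by move=> k /(sub_gen_by_relgen _ HT)/min_r/ssrnat.leP.
Qed.

Lemma quot_center_gen_relgen (G : group) k :
  quot_center_gen_by G k <-> relgen (fun _ : G => True) in_center k.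
Proof.
split=> [[x Hx]|[x [_ Hx]]]; exists x; first by [].
by move=> g; exact: Hx.
Qed.

Lemma quot_center_rank_relrank (G : group) r :
  quot_center_rank G r <-> relrank (fun _ : G => True) in_center r.
Proof.
split=> -[/quot_center_gen_relgen gr min_r]; split=> //.
  by move=> k /quot_center_gen_relgen/min_r/ssrnat.leP.
by move=> k /quot_center_gen_relgen/min_r/ssrnat.leP.
Qed.

(** * The presented group *)

Lemma eqmod_triv (G : group) (x y : G) : eqmod (@eq G gone) x y <-> x = y.
Proof.
rewrite /eqmod; split=> [e|->]; last by rewrite gmulVx.
by apply: (@gmulI _ (ginv x)); rewrite gmulVx.
Qed.

Definition commute_with (G : group) (X : G -> Prop) (s : G) : Prop :=
  forall x, X x -> s ** x = x ** s.

Lemma subgroup_commute_with (G : group) (X : G -> Prop) : subgroup (commute_with X).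
Proof.
split=> [x _|s t Hs Ht x Xx|s Hs x Xx]; first by rewrite gmul1x gmulx1.
  by rewrite -gmulA Ht // gmulA Hs // gmulA.
by apply: (@gmulI _ s); rewrite !gmulA gmulxV gmul1x Hs // gmulK.
Qed.

(** The generators lie in the centralizer of s, which is a subgroup. *)
Lemma commute_with_gen (G : group) (X : G -> Prop) s :
  commute_with X s -> commute_with (gen X) s.
Proof.
move=> Hs x Xx; have Hx : commute_with (eq s) x.
  apply: gen_sub Xx; first exact: subgroup_commute_with.
  by move=> {}x Xx _ <-; rewrite Hs.
by rewrite Hx.
Qed.

(** By [gh,y] = h^-1 [g,y] h [h,y] and [g^-1,y] = g [g,y]^-1 g^-1, where the conjugations are
    trivial on [S]. The second argument follows from [g,h]^-1 = [h,g]. *)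
Lemma comm_gen (G : group) (X S : G -> Prop) :
  subgroup S -> (forall s, S s -> commute_with X s) ->
  (forall x y, X x -> X y -> S (comm x y)) ->
  forall g h, gen X g -> gen X h -> S (comm g h).
Proof.
move=> HS SX XX; have [S1 SM SV] := HS.
have [_ XM XV] := subgroup_gen X.
have cS s x : S s -> gen X x -> x ** s ** ginv x = s.
  by move=> Ss Xx; rewrite -(commute_with_gen (SX s Ss)) // gmulK.
have step y g : (forall x, X x -> S (comm x y)) -> gen X g -> S (comm g y).
  move=> Xy; elim=> {g} [x /Xy //||g h Xg Sg Xh Sh|g Xg Sg].
  - by rewrite /comm !group_simp.
  - have := SM _ _ Sg Sh; rewrite -{1}(cS _ _ Sg (XV _ Xh)).
    by rewrite /comm !group_simp.
  - have := SV _ Sg; rewrite -(cS _ _ (SV _ Sg) Xg).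
    by rewrite /comm !group_simp.
move=> g h Xg Xh; apply: (step _ _) => // x Xx; rewrite -ginv_comm; apply: SV.
by apply: (step _ _) => // z Xz; exact: XX.
Qed.

Lemma zpow_int (G : group) (x : G) z : zpow x z = ipow x (ssrZ.int_of_Z z).
Proof. by rewrite -zpow_ipow ssrZ.int_of_ZK. Qed.

(** Stated for the subgroup [T] generated by [a] and [c], because [independent_universal] needs
    normal forms in a product of groups that these elements need not generate. *)
Lemma pres_abquo (G : group) n m lam (a c : nat -> G) :
  pres_relations G n m lam a c ->
  let T := gen (fun y => fam G n a y \/ fam G m c y) in
  [/\ abquo T (gen (fam G m c)), abquo (gen (fam G m c)) (@eq G gone)
    & forall s, gen (fam G m c) s -> commute_with T s].
Proof.
move=> [aa [ac cc]] T; set X := fun y => fam G n a y \/ fam G m c y in T *.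
have HC := subgroup_gen (fam G m c); have [C1 CM CV] := HC.
have CX s : gen (fam G m c) s -> commute_with X s.
  apply: gen_sub; first exact: subgroup_commute_with.
  move=> _ [j [jm ->]] _ [[i [im ->]]|[i [im ->]]]; apply/commP; last exact: cc.
  by rewrite -ginv_comm ac // ginv1.
have aaC i j : (i < j)%coq_nat -> (j < n)%coq_nat -> gen (fam G m c) (comm (a i) (a j)).
  move=> ij jn; rewrite aa //; apply: subgroup_prod => // t /ssrnat.ltP tm.
  by rewrite zpow_int; apply: subgroup_ipow => //; apply: gen_base; exists t.
split; last by [move=> s Cs; apply: commute_with_gen; exact: CX].
all: split=> //; try exact: subgroup_gen; try exact: subgroup_triv.
- by apply: gen_mono => y; right.
- apply: comm_gen => // _ _ [[i [im ->]]|[i [im ->]]] [[j [jm ->]]|[j [jm ->]]].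
  + have [ij|[->|ji]] := Nat.lt_total i j; first exact: aaC.
      by have /commP -> : a j ** a j = a j ** a j by [].
    by rewrite -ginv_comm; apply: CV; exact: aaC.
  + by rewrite ac.
  + by rewrite -ginv_comm ac // ginv1.
  + by rewrite cc.
- by move=> _ <-.
- move=> x y Cx Cy; apply/esym/commP; apply: (commute_with_gen (CX x Cx)).
  by apply: gen_mono Cy => z; right.
Qed.

Lemma pres_normal_form (G : group) n m lam (a c : nat -> G) g :
  pres_relations G n m lam a c ->
  gen (fun y => fam G n a y \/ fam G m c y) g ->
  exists (v : 'rV_n) (u : 'rV_m), g = wprod a v ** wprod c u.
Proof.
move=> /pres_abquo[TC C1 _] Tg.
have Ta i : (i < n)%N -> gen (fun y => fam G n a y \/ fam G m c y) (a i).
  by move=> /ssrnat.ltP ik; apply: gen_base; left; exists i.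
have Cc i : (i < m)%N -> gen (fam G m c) (c i).
  by move=> /ssrnat.ltP ik; apply: gen_base; exists i.
have [|v Cv] := @gen_wprod _ _ _ n a g TC Ta.
  by apply: gen_mono Tg => y [Ay|Cy]; [left|right; exact: gen_base].
have [|u /eqmod_triv eu] := @gen_wprod _ _ _ m c (ginv (wprod a v) ** g) C1 Cc.
  by apply: gen_mono Cv => y; left.
by exists v, u; rewrite eu !group_simp.
Qed.

(** Only entries with i < j are kept: then b(e_i,e_j) = lambda^(ij) and b(e_j,e_i) = 0, so the
    commutator of the lifts of e_i and e_j is exactly lambda^(ij). *)
Definition bform n m (lam : nat -> nat -> nat -> Z) (v w : 'rV[int]_n) : 'rV[int]_m :=
  \row_t (v *m (\matrix_(i, j) if (i < j)%N then ssrZ.int_of_Z (lam i j t) else 0)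
            *m w^T) 0 0.

Lemma bformDl n m lam u v w : @bform n m lam (u + v) w = bform m lam u w + bform m lam v w.
Proof. by apply/rowP => t; rewrite mxE mulmxDl mulmxDl !mxE. Qed.

Lemma bformDr n m lam u v w : @bform n m lam w (u + v) = bform m lam w u + bform m lam w v.
Proof. by apply/rowP => t; rewrite mxE linearD mulmxDr !mxE. Qed.

Lemma bform0l n m lam w : @bform n m lam 0 w = 0.
Proof. by apply: (@addrI _ (bform m lam 0 w)); rewrite -bformDl !addr0. Qed.

Lemma bform0r n m lam w : @bform n m lam w 0 = 0.
Proof. by apply: (@addrI _ (bform m lam w 0)); rewrite -bformDr !addr0. Qed.

Lemma bform_unitv n m lam i j : (i < n)%N -> (j < n)%N ->
  @bform n m lam (unitv n i) (unitv n j) =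
  if (i < j)%N then \row_t ssrZ.int_of_Z (lam i j t) else 0.
Proof.
move=> ik jk; rewrite -[i]/(val (Ordinal ik)) -[j]/(val (Ordinal jk)) !unitv_delta.
apply/rowP => t; rewrite mxE -rowE trmx_delta -colE !mxE.
by case: ifP; rewrite mxE.
Qed.

Lemma model_mulA n m lam (x y z : 'rV[int]_n * 'rV[int]_m) :
  let mul x y := (x.1 + y.1, x.2 + y.2 + bform m lam x.1 y.1) in
  mul x (mul y z) = mul (mul x y) z.
Proof.
rewrite /= bformDl bformDr !addrA; congr (_, _).
by rewrite [LHS](ACl (1*2*5*3*6*4)%AC).
Qed.

Lemma model_mul1 n m lam (x : 'rV[int]_n * 'rV[int]_m) :
  (0 + x.1, 0 + x.2 + bform m lam 0 x.1) = x.
Proof. by rewrite bform0l !add0r addr0 -surjective_pairing. Qed.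

Lemma model_mulV n m lam (x : 'rV[int]_n * 'rV[int]_m) :
  (- x.1 + x.1, - x.2 + bform m lam x.1 x.1 + x.2 + bform m lam (- x.1) x.1) = (0, 0).
Proof.
by rewrite addNr (addrAC (- x.2)) addNr add0r -bformDl subrr bform0l.
Qed.

(** Bilinearity of the twist gives associativity; the term b(v,v) in the inverse cancels b(-v,v). *)
Definition model n m (lam : nat -> nat -> nat -> Z) : group :=
  @Defs.Group ('rV[int]_n * 'rV[int]_m)%type
    (fun x y => (x.1 + y.1, x.2 + y.2 + bform m lam x.1 y.1))
    (fun x => (- x.1, - x.2 + bform m lam x.1 x.1)) (0, 0)
    (@model_mulA n m lam) (@model_mul1 n m lam) (@model_mulV n m lam).

Lemma additive_model_snd n m lam :
  additive_on (fun x : model n m lam => x.1 = 0) (fun x : model n m lam => x.2).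
Proof. by move=> x y /= -> _; rewrite bform0l addr0. Qed.

Lemma subgroup_model_fst0 n m lam : subgroup (fun x : model n m lam => x.1 = 0).
Proof. by split=> //= [x y -> ->|x ->]; rewrite ?addr0 ?oppr0. Qed.

Lemma model_pres n m lam :
  pres_relations (model n m lam) n m lam
    (fun i => (unitv n i, 0)) (fun t => (0, unitv m t)).
Proof.
split; last first.
  split=> [i j _ _|k r _ _]; apply/commP; rewrite /= ?bform0l ?bform0r.
    by rewrite !addr0 !add0r.
  by rewrite !addr0 (addrC (unitv m k)).
move=> i j ij /ssrnat.ltP jn; move/ssrnat.ltP: ij => ij; apply: comm_unique.
have F0 := subgroup_model_fst0 n m lam; have S0 := @additive_model_snd n m lam.
set f := fun t => zpow _ _.
have f0 t : (t < m)%N -> (f t).1 = 0.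
  by move=> _; rewrite /f zpow_int; apply: subgroup_ipow F0 _.
have p1 : (prod_upto (model n m lam) m f).1 = 0 by exact: subgroup_prod F0 f0.
have p2 : (prod_upto (model n m lam) m f).2 = \row_t ssrZ.int_of_Z (lam i j t).
  rewrite (additive_on_prod F0 S0 f0) -[RHS]row_sum_unitv; apply: eq_bigr => t _.
  by rewrite /f zpow_int (additive_on_ipow _ F0 S0) // coef_ord mxE.
rewrite /= p1 p2 !bform_unitv ?(ltn_trans ij jn) // ij ltnNge (ltnW ij) /=.
by rewrite bform0r !addr0 !add0r addrC.
Qed.

(** * Presentations and central extensions *)

Definition central_extension (G : group) (n m : nat) : Prop :=
  exists C : G -> Prop,
    [/\ subgroup C, forall x, C x -> in_center x, forall x y : G, C (comm x y),
        relfree (fun _ => True) C n & relfree C (@eq G gone) m].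

Lemma hom1 (G H : group) (f : G -> H) : group_hom G H f -> f gone = gone.
Proof. by move=> Hf; apply: (@gmulI _ (f gone)); rewrite -Hf !gmulx1. Qed.

(** The universal property serves only to obtain a homomorphism [f] to [model]. Its first component
    gives coordinates on G/C; its second is additive on C, where the twist vanishes. *)
Lemma presentation_extension (G : group) n m :
  has_presentation G n m -> central_extension G n m.
Proof.
move=> [lam [a [c [rel [gens univ]]]]].
have [f [Hf [fa fc]]] := univ _ _ _ (@model_pres n m lam).
have [TC C1 CT] := pres_abquo rel; have [_ HC _ TTC] := TC.
have HT := subgroup_full G.
have p1 : additive_on (fun _ : G => True) (fun g => (f g).1) by move=> x y _ _; rewrite Hf.
have Ta i : (i < n)%N -> gen (fun y => fam G n a y \/ fam G m c y) (a i) by [].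
have C0 g : gen (fam G m c) g -> (f g).1 = 0.
  apply: (@gen_sub _ _ (fun g => (f g).1 = 0)).
    split=> [|x y fx fy|x fx]; first exact: additive_on1 HT p1.
      by rewrite p1 // fx fy addr0.
    by rewrite (additive_onV HT p1) // fx oppr0.
  by move=> _ [j [jm ->]]; rewrite fc.
have p2 : additive_on (gen (fam G m c)) (fun g => (f g).2).
  by move=> x y Cx Cy; rewrite Hf /= (C0 x Cx) bform0l addr0.
have a1 (v : 'rV_n) : (f (wprod a v)).1 = v.
  by apply: (additive_on_wprod v HT p1) => i /ssrnat.ltP ik; rewrite fa.
have Cc i : (i < m)%N -> gen (fam G m c) (c i).
  by move=> /ssrnat.ltP ik; apply: gen_base; exists i.
have c2 (u : 'rV_m) : (f (wprod c u)).2 = u.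
  apply: (additive_on_wprod u HC p2) => i ik; split; first exact: Cc.
  by rewrite fc //; exact/ssrnat.ltP.
have Cw (u : 'rV_m) : gen (fam G m c) (wprod c u) by exact: wprod_mem.
have nf g := pres_normal_form rel (gens g).
exists (gen (fam G m c)); split=> //.
- by move=> x Cx y; exact: CT.
- by move=> x y; exact: TTC.
- exists (fun g => (f g).1); split=> // [v|t _]; first by exists (wprod a v).
  (* The first component of the image of a^v c^u is v; if it is 0, the element reduces to c^u modulo
     C. *)
  split=> [|/C0 //]; have [v [u ->]] := nf t.
  rewrite p1 // a1 C0 // addr0 => ->; have [_ CM _] := HC; apply: CM => //.
  exact: quohom0 (quohom_wprod TC Ta).
- exists (fun g => (f g).2); split=> // [v|t Ct]; first by exists (wprod c v).
  split=> [t0|<-]; last exact: additive_on1 HC p2.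
  have [u /eqmod_triv eu] := @gen_wprod _ _ _ m c _ C1 Cc (gen_mono (fun y Cy => or_introl Cy) Ct).
  by rewrite -eu c2 in t0; rewrite -eu t0; exact: quohom0 (quohom_wprod C1 Cc).
Qed.

Lemma hom_inv (G H : group) (f : G -> H) x : group_hom G H f -> f (ginv x) = ginv (f x).
Proof.
by move=> Hf; apply: (@gmulI _ (f x)); rewrite -Hf !gmulxV; exact: hom1.
Qed.

Lemma hom_ipow (G H : group) (f : G -> H) x z :
  group_hom G H f -> f (ipow x z) = ipow (f x) z.
Proof.
move=> Hf; have Hn n : f (npow x n) = npow (f x) n.
  by elim: n => [|n IHn]; [exact: hom1|rewrite /= Hf IHn].
by case: z => n; rewrite /ipow ?(hom_inv _ Hf) Hn.
Qed.

Lemma eq_prod_upto (G : group) k (f g : nat -> G) :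
  (forall i, (i < k)%N -> f i = g i) -> prod_upto G k f = prod_upto G k g.
Proof.
elim: k => [//|k IHk] fg /=; rewrite fg // IHk // => i ik.
by apply: fg; exact: ltnW.
Qed.

Lemma hom_prod (G H : group) (f : G -> H) k x :
  group_hom G H f -> f (prod_upto G k x) = prod_upto H k (fun i => f (x i)).
Proof.
by move=> Hf; elim: k => [|k IHk]; [exact: hom1|rewrite /= Hf IHk].
Qed.

Lemma hom_wprod (G H : group) (f : G -> H) k x (v : 'rV_k) :
  group_hom G H f -> f (wprod x v) = wprod (fun i => f (x i)) v.
Proof.
move=> Hf; rewrite /wprod (hom_prod _ _ Hf).
by apply: eq_prod_upto => i _; exact: hom_ipow.
Qed.

Lemma wprod0 (G : group) k (x : nat -> G) : wprod x (0 : 'rV_k) = gone.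
Proof.
have coef0 i : coef (0 : 'rV_k) i = 0 by rewrite /coef; case: insub => //= j; rewrite mxE.
by rewrite /wprod; elim: {1}k => [//|l IHl] /=; rewrite IHl coef0 gmul1x.
Qed.

Definition gprod (G H : group) : group.
refine (@Defs.Group (G * H)%type
  (fun x y => (x.1 ** y.1, x.2 ** y.2)) (fun x => (ginv x.1, ginv x.2)) (gone, gone) _ _ _).
- by move=> x y z /=; rewrite !gmulA.
- by case=> x y; rewrite /= !gmul1x.
- by move=> x; rewrite /= !gmulVx.
Defined.

Lemma gprod_pres (G H : group) n m lam (a c : nat -> G) (a' c' : nat -> H) :
  pres_relations G n m lam a c -> pres_relations H n m lam a' c' ->
  pres_relations (gprod G H) n m lam (fun i => (a i, a' i)) (fun j => (c j, c' j)).
Proof.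
have H1 : group_hom (gprod G H) G fst by [].
have H2 : group_hom (gprod G H) H snd by [].
move=> [aa [ac cc]] [aa' [ac' cc']]; split; last first.
  split=> i j im jm.
    by have := congr2 pair (ac i j im jm) (ac' i j im jm).
  by have := congr2 pair (cc i j im jm) (cc' i j im jm).
move=> i j ij jn; rewrite [RHS]surjective_pairing (hom_prod _ _ H1) (hom_prod _ _ H2).
have -> : comm ((a i, a' i) : gprod G H) (a j, a' j) = (comm (a i) (a j), comm (a' i) (a' j)) by [].
rewrite aa // aa' //; congr pair; apply: eq_prod_upto => t _.
  by rewrite !zpow_int (hom_ipow _ _ H1).
by rewrite !zpow_int (hom_ipow _ _ H2).
Qed.

(* The subgroup of [G * H] generated by the pairs [(a i, a' i)], [(c j, c' j)]
   satisfies the relations, so its elements have normal forms; independence of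
   [a], [c] in [G] makes it the graph of the required homomorphism. *)
Lemma independent_universal (G H : group) n m lam (a c : nat -> G) (a' c' : nat -> H) :
  pres_relations G n m lam a c ->
  (forall g, gen (fun y => fam G n a y \/ fam G m c y) g) ->
  (forall (v : 'rV_n) (u : 'rV_m), wprod a v ** wprod c u = gone -> v = 0 /\ u = 0) ->
  pres_relations H n m lam a' c' ->
  exists f : G -> H, group_hom G H f /\
    (forall i, (i < n)%coq_nat -> f (a i) = a' i) /\
    (forall j, (j < m)%coq_nat -> f (c j) = c' j).
Proof.
move=> relG genG indep relH; have rel := gprod_pres relG relH.
set ta := fun i => _ in rel; set tc := fun j => _ in rel.
pose X y := fam (gprod G H) n ta y \/ fam (gprod G H) m tc y.
have [X1 XM XV] := subgroup_gen X.
have H1 : group_hom (gprod G H) G fst by [].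
(* The first component of the normal form of (1,h) is a trivial word in G; independence makes its
   exponents 0, hence h = 1. *)
have uniq1 h : gen X (gone, h) -> h = gone.
  move=> /(pres_normal_form rel)[v [u e]].
  have := congr1 fst e; rewrite H1 (hom_wprod _ _ H1) (hom_wprod _ _ H1) /=.
  move/esym/indep => [v0 u0]; move: e; rewrite v0 u0 !wprod0 gmul1x.
  by case.
have uniqX g h h' : gen X (g, h) -> gen X (g, h') -> h = h'.
  move=> Xh Xh'; have := XM _ _ (XV _ Xh) Xh'.
  have -> : ginv ((g, h) : gprod G H) ** (g, h') = (ginv g ** g, ginv h ** h') by [].
  by rewrite gmulVx => /uniq1 e; apply: (@gmulI _ (ginv h)); rewrite e gmulVx.
have Xa i : (i < n)%coq_nat -> gen X (a i, a' i).
  by move=> ik; apply: gen_base; left; exists i.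
have Xc i : (i < m)%coq_nat -> gen X (c i, c' i).
  by move=> ik; apply: gen_base; right; exists i.
have ex g : exists h, gen X (g, h).
  elim: (genG g) => {g} [_ [[i [ik ->]]|[i [ik ->]]]||x y _ [h Xh] _ [h' Xh']|x _ [h Xh]].
  - by exists (a' i); exact: Xa.
  - by exists (c' i); exact: Xc.
  - by exists gone.
  - by exists (h ** h'); exact: XM _ _ Xh Xh'.
  - by exists (ginv h); exact: XV _ Xh.
have [f Hf] := choice ex; exists f; split=> [x y|].
  by apply: uniqX (Hf _) _; exact: XM _ _ (Hf x) (Hf y).
split=> i ik; apply: uniqX (Hf _) _; [exact: Xa|exact: Xc].
Qed.

Lemma extension_presentation (G : group) n m :
  central_extension G n m -> has_presentation G n m.
Proof.
move=> [C [HC CZ CC [p [Hp onto_p ker_p]] [q [Hq onto_q ker_q]]]].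
have HT := subgroup_full G.
have [a Ha] := relfree_basis onto_p.
have [c Hc] := relfree_basis onto_q.
have p_a (v : 'rV_n) : p (wprod a v) = v by apply: (additive_on_wprod v HT Hp).
have q_c (u : 'rV_m) : q (wprod c u) = u.
  by apply: (additive_on_wprod u HC Hq) => i _; exact: Hc.
have C_c (u : 'rV_m) : C (wprod c u) by apply: wprod_mem => // i _; exact: (Hc i).1.
have eq_c x : C x -> wprod c (q x) = x.
  move=> Cx; apply/eqmod_triv.
  exact: (additive_on_eq HC Hq ker_q (C_c _) Cx (q_c _)).
have eq_a g : exists u : 'rV_m, g = wprod a (p g) ** wprod c u.
  have := additive_on_eq HT Hp ker_p I I (p_a (p g)) => /eq_c e.
  by exists (q (ginv (wprod a (p g)) ** g)); rewrite e gmulA gmulxV gmul1x.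
(* The structure constants are the coordinates of [a_i,a_j], an element of C, in the basis [c]. *)
pose lam i j t := ssrZ.Z_of_int (coef (q (comm (a i) (a j))) t).
have rel : pres_relations G n m lam a c.
  split=> [i j _ _|].
    rewrite -[LHS]eq_c //; apply: eq_prod_upto => t _.
    by rewrite /lam zpow_ipow.
  split=> [i j _ _|k r _ _]; apply/commP; last by rewrite (CZ _ (Hc k).1).
  by rewrite (CZ _ (Hc j).1).
have gens g : gen (fun y => fam G n a y \/ fam G m c y) g.
  have HX := subgroup_gen (fun y => fam G n a y \/ fam G m c y).
  have [u ->] := eq_a g; have [_ XM _] := HX.
  apply: XM; apply: wprod_mem => // i /ssrnat.ltP ik; apply: gen_base.
    by left; exists i.
  by right; exists i.
exists lam, a, c; split=> //; split=> // H a' c' relH.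
apply: independent_universal rel gens _ relH => v u e.
(* [p] kills C and reads off v; then [q] reads off u. *)
have v0 : v = 0.
  have := congr1 p e; rewrite Hp // p_a (additive_on1 HT Hp).
  by rewrite (proj2 (ker_p (wprod c u) I)) ?addr0.
split=> //; move: e; rewrite v0 wprod0 gmul1x => e.
by rewrite -[u]q_c e (additive_on1 HC Hq).
Qed.

(** * Ranks *)

Lemma npowD (G : group) (x : G) k l : npow x (k + l) = npow x k ** npow x l.
Proof.
elim: l => [|l IHl]; first by rewrite addn0 gmulx1.
by rewrite addnS /= IHl gmulA.
Qed.

Lemma npowM (G : group) (x : G) k l : npow x (k * l) = npow (npow x k) l.
Proof. by elim: l => [|l IHl]; rewrite ?muln0 // mulnSr npowD IHl. Qed.

Lemma npow1 (G : group) n : npow gone n = gone :> G.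
Proof. by elim: n => //= n ->; rewrite gmul1x. Qed.

Lemma npow_central (G : group) (x y : G) n :
  in_center x -> npow (x ** y) n = npow x n ** npow y n.
Proof.
move=> Zx; elim: n => [|n IHn]; first by rewrite gmul1x.
have Zn := subgroup_npow n (subgroup_center G) Zx.
by rewrite /= IHn -!gmulA; congr (_ ** _); rewrite !gmulA -(Zx (npow y n)).
Qed.

Lemma comm_npow (G : group) (x y : G) n :
  two_step_nilpotent G -> comm (npow x n) y = npow (comm x y) n.
Proof.
move=> nil2; elim: n => [|n IHn]; first by rewrite /comm !group_simp.
rewrite [RHS]/= -IHn.
transitivity (ginv x ** comm (npow x n) y ** x ** comm x y).
  by rewrite /comm /= !group_simp.
by rewrite -(nil2 (npow x n) y (ginv x)) gmulKV.
Qed.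

(** If x^n is central, then [x,y]^n = [x^n,y] = 1, so [x,y] = 1 by torsion-freeness. *)
Lemma pure_center (G : group) :
  torsion_free G -> two_step_nilpotent G -> pure_in (fun _ : G => True) in_center.
Proof.
move=> tf nil2 x n _ /ssrnat.ltP n0 Zn y; apply/commP; apply: tf n0 _.
by rewrite -comm_npow //; apply/commP; exact: Zn.
Qed.

Lemma pure_triv (G : group) (T : G -> Prop) : torsion_free G -> pure_in T (@eq G gone).
Proof. by move=> tf x n _ /ssrnat.ltP n0 e; rewrite (tf x n n0). Qed.

Lemma abquo_central (G : group) (T : G -> Prop) :
  subgroup T -> (forall x, T x -> in_center x) -> abquo T (@eq G gone).
Proof.
move=> HT TZ; split=> //; [exact: subgroup_triv|by case: HT => T1 _ _ _ <-|].
by move=> x y Tx _; apply/esym/commP; exact: TZ.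
Qed.

Lemma derived_comm (G : group) (x y : G) : derived (comm x y).
Proof. by apply: gen_base; exists x, y. Qed.

Lemma derived_central (G : group) x :
  two_step_nilpotent G -> derived x -> in_center (x : G).
Proof.
by move=> nil2; apply: gen_sub; [exact: subgroup_center|move=> _ [g [h ->]]; exact: nil2].
Qed.

Lemma abquo_full (G : group) (C : G -> Prop) :
  subgroup C -> (forall x y, C (comm x y)) -> abquo (fun _ : G => True) C.
Proof. by move=> HC CC; split. Qed.

(** Written with the arithmetic of the theorem, so that it is convertible with its last clause. *)
Definition rank_conditions (G : group) (n m : nat) : Prop :=
  exists rq rz rd : nat,
    quot_center_rank G rq /\ sub_rank G (@in_center G) rz /\
    sub_rank G (@derived G) rd /\
    (rq + rz)%coq_nat = (n + m)%coq_nat /\ (rd <= m)%coq_nat /\ (m <= rz)%coq_nat.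

(** G' is a subgroup of the k-generated abelian group [C], hence k-generated, and being torsion-free
    it is free of rank at most k. *)
Lemma derived_rank (G : group) (C : G -> Prop) k :
  torsion_free G -> two_step_nilpotent G -> subgroup C ->
  (forall x, C x -> in_center x) -> (forall x y, C (comm x y)) ->
  relgen C (@eq G gone) k -> exists rd, (rd <= k)%N /\ sub_rank G (@derived G) rd.
Proof.
move=> tf nil2 HC CZ CC gC.
have HD : subgroup (@derived G) by exact: subgroup_gen.
have D1 x : gone = x -> derived (x : G) by case: HD => D1 _ _ <-.
have DC x : derived x -> C x by apply: gen_sub => // _ [g [h ->]].
have DZ x (Dx : derived x) := derived_central nil2 Dx.
have gD := relgen_subgroup (abquo_central HC CZ) HD D1 DC gC.
have [rd [rdk FD]] := relgen_relfree (abquo_central HD DZ) (pure_triv tf) gD.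
exists rd; split=> //; apply/sub_rank_relrank => //.
exact: relfree_relrank.
Qed.

Lemma extension_rank_conditions (G : group) n m :
  central_extension G n m ->
  [/\ finitely_generated G, torsion_free G, two_step_nilpotent G & rank_conditions G n m].
Proof.
move=> [C [HC CZ CC FG FC]].
have HT := subgroup_full G; have HZ := subgroup_center G; have H1 := subgroup_triv G.
have C1 x : gone = x -> C x by case: HC => C1 _ _ <-.
have tf : torsion_free G.
  (* A torsion element lies in C because G/C is torsion-free, and is then trivial because C is. *)
  move=> x k /ssrnat.ltP k0 e; apply/esym/(relfree_pure HC H1 FC _ k0); last by rewrite e.
  by apply: (relfree_pure HT HC FG I k0); rewrite e; case: HC.
have nil2 : two_step_nilpotent G by move=> x y; exact/CZ/CC.
split=> //.
  exists (n + m)%N; have [//|x [_ Hx]] := relgen_trans _ (relfree_relgen HT FG) (relfree_relgen HC FC).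
  exists x => g; apply: gen_sub (Hx g I); first exact: subgroup_gen.
  by move=> y [|<-]; [exact: gen_base|exact: gen_one].
have pZ := pure_center tf nil2.
(* With s = rank G/Z(G) and r = rank Z(G)/C one has n = r + s, and rank Z(G) = r + m, so the ranks
   add up to n + m. *)
have [r [s [en FGZ FZC]]] := relfree_split HT HZ CZ (fun _ _ => I) pZ FG.
have aZ := abquo_central HZ (fun _ Zx => Zx).
have FZ := relfree_ext aZ HC C1 CZ FZC FC.
have [rd [rdm Hrd]] := derived_rank tf nil2 HC CZ CC (relfree_relgen HC FC).
exists s, (r + m)%N, rd; split.
  by apply/quot_center_rank_relrank; exact: relfree_relrank.
split; first by apply/sub_rank_relrank => //; apply: relfree_relrank => // x <-; case: HZ.
by split=> //; lia.
Qed.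

(** Take for [U] the elements whose first k coordinates vanish. This enlarges [S] to a direct
    summand of prescribed corank. *)
Lemma relfree_truncate (G : group) (T S : G -> Prop) k l :
  subgroup T -> (forall x, S x -> T x) -> relfree T S (k + l) ->
  exists U, [/\ subgroup U, forall x, S x -> U x, forall x, U x -> T x & relfree T U k].
Proof.
move=> HT ST [p [Hp onto_p ker_p]]; have [T1 TM TV] := HT.
exists (fun x => T x /\ lsubmx (p x) = 0); split.
- split=> [|x y [Tx px] [Ty py]|x [Tx px]]; split; auto.
  + by rewrite (additive_on1 HT Hp) linear0.
  + by rewrite Hp // linearD /= px py addr0.
  + by rewrite (additive_onV HT Hp) // linearN /= px oppr0.
- move=> x Sx; have Tx := ST _ Sx; split=> //.
  by rewrite (proj2 (ker_p x Tx) Sx) linear0.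
- by move=> x [].
exists (fun x => lsubmx (p x)); split=> [x y Tx Ty|v|t Tt].
- by rewrite Hp // linearD.
- have [t [Tt pt]] := onto_p (row_mx v 0).
  by exists t; rewrite pt row_mxKl.
- by split=> [|[]].
Qed.

(** The isolator is taken inside Z(G), where powers are multiplicative, so that it is a subgroup. *)
Definition saturation (G : group) (S : G -> Prop) (x : G) : Prop :=
  in_center x /\ exists n, (0 < n)%N /\ S (npow x n).

Lemma subgroup_saturation (G : group) (S : G -> Prop) :
  subgroup S -> subgroup (saturation S).
Proof.
move=> HS; have [S1 SM SV] := HS; have [Z1 ZM ZV] := subgroup_center G.
split=> [|x y [Zx [k [k0 Sk]]] [Zy [l [l0 Sl]]]|x [Zx [k [k0 Sk]]]].
- by split=> //; exists 1%N; rewrite /= gmul1x.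
- split; first exact: ZM.
  exists (k * l)%N; split; first by rewrite muln_gt0 k0.
  rewrite npow_central //; apply: SM; first by rewrite npowM; exact: subgroup_npow.
  by rewrite mulnC npowM; exact: subgroup_npow.
- split; first exact: ZV.
  exists k; split=> //; suff -> : npow (ginv x) k = ginv (npow x k) by exact: SV.
  apply: (@gmulI _ (npow x k)); rewrite gmulxV -npow_central // gmulxV.
  exact: npow1.
Qed.

Lemma rank_conditions_extension (G : group) n m :
  torsion_free G -> two_step_nilpotent G -> rank_conditions G n m ->
  central_extension G n m.
Proof.
move=> tf nil2 [rq [rz [rd [/quot_center_rank_relrank Rq [Rz [Rd [enm [rdm mrz]]]]]]]].
have HT := subgroup_full G; have HZ := subgroup_center G; have H1 := subgroup_triv G.
have HD : subgroup (@derived G) by exact: subgroup_gen.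
move/(sub_rank_relrank _ HZ): Rz => Rz; move/(sub_rank_relrank _ HD): Rd => [gD _].
have aGZ := abquo_full HZ nil2.
have aZ := abquo_central HZ (fun _ Zx => Zx).
have FGZ := relrank_relfree aGZ (pure_center tf nil2) Rq.
have FZ := relrank_relfree aZ (pure_triv tf) Rz.
pose D := saturation (@derived G); have HsD : subgroup D := subgroup_saturation HD.
have DZ x : D x -> in_center x by case.
have D1 x : gone = x -> D x by case: HsD => D1 _ _ <-.
have dD x : derived x -> D x.
  by move=> Dx; split; [exact: derived_central|exists 1%N; rewrite /= gmul1x].
have pD : pure_in in_center D.
  move=> x k Zx k0 [_ [l [l0]]]; rewrite -npowM => Dkl; split=> //.
  by exists (k * l)%N; rewrite muln_gt0 k0.
have [r [s [erz FZD FD]]] := relfree_split HZ HsD D1 DZ pD FZ.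
(* Each element of [D] has a positive power in G', which is generated by rd elements. *)
have rrd : (r <= rd)%N.
  by apply: (relfree_le_relgen HsD D1 dD _ FD gD) => x [].
(* Z(G)/D has rank rz - r, and r <= rd <= m <= rz. Keeping rz - m of its coordinates leaves a
   subgroup C of rank m that contains D. *)
have [e es] : exists e, s = ((rz - m) + e)%N by exists (m - r)%N; lia.
rewrite {}es in erz FZD.
have [C [HC DC CZ FZC]] := relfree_truncate HZ DZ FZD.
have C1 x : gone = x -> C x by move=> /D1/DC.
have [r' [s' [erz' FZC' FC]]] := relfree_split HZ HC C1 CZ (relfree_pure HZ HC FZC) FZ.
have es' := relfree_unique HZ CZ FZC FZC'.
have CC x y : C (comm x y) by apply/DC/dD/derived_comm.
exists C; split=> //; last by have -> : m = r' by lia.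
(* The rank of G/C as the sum of those of G/Z(G) and Z(G)/C. *)
have -> : n = (rq + (rz - m))%N by lia.
exact: relfree_ext (abquo_full HC CC) HZ CZ _ FGZ FZC.
Qed.

(** The k^2 commutators of generators generate a central subgroup [D] containing all commutators.
    Then Z(G)/D is a subgroup of the finitely generated abelian group G/D, and [D] itself is
    finitely generated. *)
Lemma center_finitely_generated (G : group) :
  finitely_generated G -> two_step_nilpotent G ->
  exists k, relgen in_center (@eq G gone) k.
Proof.
move=> [k [x Hx]] nil2; have HZ := subgroup_center G.
(* Index i k + j stands for the pair (i,j). *)
pose y i := comm (x (i %/ k)%N) (x (i %% k)%N).
pose D := gen (fam G (k * k)%N y); have HD : subgroup D by exact: subgroup_gen.
have DZ z : D z -> in_center z.
  by apply: gen_sub => // _ [i [_ ->]]; exact: nil2.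
have DC g h : D (comm g h).
  apply: (@comm_gen _ (fam G k x)) => // [s /DZ Zs z _|_ _ [i [/ssrnat.ltP ik ->]] [j [/ssrnat.ltP jk ->]]].
    exact: Zs.
  have k0 : (0 < k)%N by exact: leq_ltn_trans ik.
  apply: gen_base; exists (i * k + j)%N; split; first by apply/ssrnat.ltP; nia.
  by rewrite /y divnMDl // divn_small // addn0 modnMDl modn_small.
have gGD : relgen (fun _ : G => True) D k.
  exists x; split=> // g _; apply: gen_mono (Hx g) => z; by left.
have gZD := relgen_subgroup (abquo_full HD DC) HZ DZ (fun _ _ => I) gGD.
have gD : relgen D (@eq G gone) (k * k)%N.
  exists y; split=> [i /ssrnat.ltP ik|g]; first by apply: gen_base; exists i.
  by apply: gen_mono => z; left.
by exists (k + k * k)%N; exact: relgen_trans DZ gZD gD.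
Qed.

Lemma rank_conditions_exist (G : group) :
  finitely_generated G -> torsion_free G -> two_step_nilpotent G ->
  exists n m, rank_conditions G n m.
Proof.
move=> fg tf nil2; have HT := subgroup_full G; have HZ := subgroup_center G.
have [l gZ] := center_finitely_generated fg nil2.
have aZ := abquo_central HZ (fun _ Zx => Zx).
have [rz [_ FZ]] := relgen_relfree aZ (pure_triv tf) gZ.
have [rd [rdz Hrd]] := derived_rank tf nil2 HZ (fun _ Zx => Zx) nil2 (relfree_relgen HZ FZ).
have [k [x Hx]] := fg.
have gGZ : relgen (fun _ : G => True) in_center k.
  by exists x; split=> // g _; apply: gen_mono (Hx g) => z; left.
have [rq [_ FGZ]] := relgen_relfree (abquo_full HZ nil2) (pure_center tf nil2) gGZ.
(* Choose n = rank G/Z(G) and m = rank Z(G), which corresponds to C = Z(G); the rank of G' is at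
   most that of Z(G). *)
exists rq, rz, rq, rz, rd; split.
  by apply/quot_center_rank_relrank; exact: relfree_relrank.
split; first by apply/sub_rank_relrank => //; apply: relfree_relrank => // z <-; case: HZ.
by split=> //; lia.
Qed.

Lemma presentation_iff (G : group) n m :
  has_presentation G n m <->
  (finitely_generated G /\ torsion_free G /\ two_step_nilpotent G /\ rank_conditions G n m).
Proof.
split=> [/presentation_extension/extension_rank_conditions[]//|[_ [tf [nil2 rc]]]].
exact/extension_presentation/rank_conditions_extension.
Qed.

Lemma presentation_exists_iff (G : group) :
  (finitely_generated G /\ torsion_free G /\ two_step_nilpotent G) <->
  exists n m, has_presentation G n m.
Proof.
split=> [[fg [tf nil2]]|[n [m /presentation_iff[fg [tf [nil2 _]]]]] //].
have [n [m rc]] := rank_conditions_exist fg tf nil2.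
by exists n, m; apply/presentation_iff.
Qed.

End NilpotentPresentation.

Theorem theorem4p1 (G : group) :
  (forall n m : nat,
     has_presentation G n m <->
     (finitely_generated G /\ torsion_free G /\ two_step_nilpotent G /\
      exists rq rz rd : nat,
        quot_center_rank G rq /\
        sub_rank G (@in_center G) rz /\
        sub_rank G (@derived G) rd /\
        rq + rz = n + m /\ rd <= m /\ m <= rz)) /\
  ((finitely_generated G /\ torsion_free G /\ two_step_nilpotent G) <->
   exists n m : nat, has_presentation G n m).
Proof.
  exact (conj (@NilpotentPresentation.presentation_iff G)
              (@NilpotentPresentation.presentation_exists_iff G)).
Qed.
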